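(* Let $\mathcal{P}=\{C_{m,n}\}_{m,n\in\mathbb{Z}}$ be a locally univalent circle packing of the hexagonal triangulation $\mathcal{T}_H$ in the complex plane $\mathbb{C}$, and let $r_{m,n}>0$ be the radius of the circle $C_{m,n}$ associated to the vertex $v_{m,n}$. If there exists a constant $c>0$ such that $$\frac{r_{m+1,n}}{r_{m,n}}\ge c\quad\text{for all } m,n\in\mathbb{Z},$$ then $\mathcal{P}$ is either a regular hexagonal packing or a Doyle spiral.
   Context: The hexagonal triangulation $\mathcal{T}_H=(H,E_H,F_H)$ of $\mathbb{C}$ has vertex set $H=\{v_{m,n}=m+ne^{\pi i/3}: m,n\in\mathbb{Z}\}$; two vertices $v,w\in H$ are joined by an edge iff $|v-w|=1$ (so the neighbors of $v_{m,n}$ are $v_{m\pm1,n}$, $v_{m,n\pm1}$, $v_{m+1,n-1}$, $v_{m-1,n+1}$); faces are the triples of pairwise adjacent vertices, oriented as in $\mathbb{C}$. A circle packing of $\mathcal{T}_H$ in $\mathbb{C}$ is a family of circles $\{C_v\}_{v\in H}$ in $\mathbb{C}$ (of positive radii) such that (1) $C_v$ and $C_w$ are externally tangent whenever $\{v,w\}\in E_H$; (2) whenever $(v_1,v_2,v_3)$ is a positively oriented face, the triple $(C_{v_1},C_{v_2},C_{v_3})$ is positively oriented (the centers are in counterclockwise order). Non-adjacent vertices may have overlapping circles. For each face, its geometric triangle is the Euclidean triangle formed by connecting the centers of the three corresponding circles by segments. The packing is locally univalent if for every vertex $v$ the geometric triangles of the (six) faces containing $v$ have mutually disjoint interiors.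 A regular hexagonal packing is a circle packing of $\mathcal{T}_H$ all of whose radii are equal. A Doyle spiral is a circle packing of $\mathcal{T}_H$ whose radii are $r_{m,n}=r_0x^my^n$ for all $m,n\in\mathbb{Z}$, for some constants $r_0,x,y>0$. *)

(* Defs.v *)
From Stdlib Require Import Reals ZArith.
From Coquelicot Require Import Coquelicot.

Local Open Scope R_scope.

(** ** Plane geometry *)

(* [conj (b - a) * (c - a)] has imaginary part twice the signed area of the
   triangle [a b c], so collinear triples are excluded. *)
Definition counterclockwise (a b c : C) : Prop :=
  0 < Im (Cmult (Cconj (Cminus b a)) (Cminus c a)).

Definition triangle (a b c : C) : C -> Prop :=
  fun p => exists s t u : R,
    0 <= s /\ 0 <= t /\ 0 <= u /\ s + t + u = 1 /\
    p = Cplus (Cplus (Cmult (RtoC s) a) (Cmult (RtoC t) b)) (Cmult (RtoC u) c).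

Definition Cinterior (A : C -> Prop) : C -> Prop :=
  fun p => locally p A.

Definition disjoint (A B : C -> Prop) : Prop :=
  forall p : C, ~ (A p /\ B p).

Record circle : Type := Circle {
  center : C;
  radius : R;
  radius_pos : 0 < radius }.

Definition externally_tangent (c1 c2 : circle) : Prop :=
  Cmod (Cminus (center c1) (center c2)) = radius c1 + radius c2.

Definition positively_oriented_circles (c1 c2 c3 : circle) : Prop :=
  counterclockwise (center c1) (center c2) (center c3).

(** ** The hexagonal triangulation *)

Definition vertex : Type := (Z * Z)%type.

(* [(m, n)] stands for m + n e^{pi i / 3}. *)
Definition vertex_pos (v : vertex) : C :=
  Cplus (RtoC (IZR (fst v)))
        (Cmult (RtoC (IZR (snd v))) (cos (PI / 3), sin (PI / 3))).

Definition adjacent (v w : vertex) : Prop :=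
  Cmod (Cminus (vertex_pos v) (vertex_pos w)) = 1.

Definition face (u v w : vertex) : Prop :=
  adjacent u v /\ adjacent v w /\ adjacent w u.

Definition positive_face (u v w : vertex) : Prop :=
  face u v w /\
  counterclockwise (vertex_pos u) (vertex_pos v) (vertex_pos w).

(** ** Circle packings *)

Definition circle_packing (P : vertex -> circle) : Prop :=
  (forall v w, adjacent v w -> externally_tangent (P v) (P w)) /\
  (forall u v w, positive_face u v w ->
     positively_oriented_circles (P u) (P v) (P w)).

Definition geometric_triangle (P : vertex -> circle) (u v w : vertex) :
    C -> Prop :=
  triangle (center (P u)) (center (P v)) (center (P w)).

(* Each face containing [v] is [{v, a, b}] for exactly one pair [(a, b)] such
   that [positive_face v a b], so distinct pairs are distinct faces. *)
Definition locally_univalent (P : vertex -> circle) : Prop :=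
  forall v a b a' b' : vertex,
    positive_face v a b -> positive_face v a' b' -> (a, b) <> (a', b') ->
    disjoint (Cinterior (geometric_triangle P v a b))
             (Cinterior (geometric_triangle P v a' b')).

Definition regular_hexagonal_packing (P : vertex -> circle) : Prop :=
  circle_packing P /\ forall v w, radius (P v) = radius (P w).

Definition doyle_spiral (P : vertex -> circle) : Prop :=
  circle_packing P /\
  exists r0 x y : R, 0 < r0 /\ 0 < x /\ 0 < y /\
    forall m n : Z, radius (P (m, n)) = r0 * powerRZ x m * powerRZ y n.

(* Main.v *)
(* Half of the angle at the center of radius [a] in the triangle of three
   mutually tangent circles of radii [a], [b], [c] is [atan (rho / a)], with [rho]
   the inradius. Local univalence makes the six angles at each vertex sum to
   [2 PI]. The derivative of the half angle with respect to [ln b] is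
   [rho / (2 (a + b))], which is positive, symmetric and at most 1/4: hence the
   logarithmic ratio [ln (r (m + 1) n / r m n)] of a packing to its translate is
   harmonic for bounded symmetric conductances on the triangular lattice. It is
   bounded below, and the lattice is recurrent, so it is constant: testing
   against [eta^2 / W], with [W] a positive harmonic function and [eta] a
   logarithmic cutoff, kills the energy of [ln W]. So
   [r (m + 1) n = x * r m n]. With [y n = r 0 (n + 1) / r 0 n], the angle equation
   at [(0, n)] involves the upper three angles, strictly increasing in [y n],
   and the lower three, depending on [y (n - 1)]. Since it is also solved by
   [y n = y (n - 1)], [y] is constant. *)

Require Import Defs.
From Stdlib Require Import Reals ZArith Lra Lia.
From Coquelicot Require Import Coquelicot.

Local Open Scope R_scope.

(** * Angles in the triangle of three mutually tangent circles *)

(** Heron's formula: the sides are [a + b], [b + c], [c + a], so the semiperimeter is [a + b + c]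
    and the area is [sqrt (a * b * c * (a + b + c))]. *)
Definition inradius (a b c : R) : R := sqrt (a * b * c / (a + b + c)).

Definition half_angle (a b c : R) : R := atan (inradius a b c / a).

Lemma inradius_arg_pos a b c :
  0 < a -> 0 < b -> 0 < c -> 0 < a * b * c / (a + b + c).
Proof.
intros; apply Rdiv_lt_0_compat; [|lra].
now repeat apply Rmult_lt_0_compat.
Qed.

Lemma inradius_pos a b c : 0 < a -> 0 < b -> 0 < c -> 0 < inradius a b c.
Proof. intros; now apply sqrt_lt_R0, inradius_arg_pos. Qed.

Lemma inradius_sqr a b c : 0 < a -> 0 < b -> 0 < c ->
  inradius a b c * inradius a b c = a * b * c / (a + b + c).
Proof. intros; apply sqrt_sqrt; left; now apply inradius_arg_pos. Qed.

Lemma inradius_rot a b c : inradius b c a = inradius a b c.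
Proof.
unfold inradius; replace (b + c + a) with (a + b + c) by ring.
now replace (b * c * a) with (a * b * c) by ring.
Qed.

Lemma inradius_scale k a b c : 0 < k -> 0 < a -> 0 < b -> 0 < c ->
  inradius (k * a) (k * b) (k * c) = k * inradius a b c.
Proof.
intros; unfold inradius.
replace (k * a * (k * b) * (k * c) / (k * a + k * b + k * c))
  with ((k * k) * (a * b * c / (a + b + c))) by (field; nra).
rewrite sqrt_mult, sqrt_square; [reflexivity|lra|nra|].
left; now apply inradius_arg_pos.
Qed.

(** Since [c / (a + b + c) <= 1], the square of the inradius is at most [a * b]; the inequality of
    arithmetic and geometric means does the rest. *)
Lemma inradius_le a b c :
  0 < a -> 0 < b -> 0 < c -> 2 * inradius a b c <= a + b.
Proof.
intros Ha Hb Hc.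
assert (Hr := inradius_pos a b c Ha Hb Hc).
assert (H2 := inradius_sqr a b c Ha Hb Hc).
assert (a * b * c / (a + b + c) <= a * b).
{ apply Rle_div_l; [lra|]. assert (0 < a * b) by nra. nra. }
apply Rsqr_incr_0; try lra.
unfold Rsqr; assert (0 <= (a - b) * (a - b)) by apply Rle_0_sqr.
nra.
Qed.

Lemma half_angle_scale k a b c : 0 < k -> 0 < a -> 0 < b -> 0 < c ->
  half_angle (k * a) (k * b) (k * c) = half_angle a b c.
Proof.
intros; unfold half_angle; rewrite inradius_scale by easy.
f_equal; field; lra.
Qed.

Lemma half_angle_bound a b c : 0 < a -> 0 < b -> 0 < c ->
  0 < half_angle a b c < PI / 2.
Proof.
intros Ha Hb Hc; split; [|apply atan_bound].
rewrite <- atan_0; apply atan_increasing, Rdiv_lt_0_compat; [|easy].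
now apply inradius_pos.
Qed.

Lemma half_angle_sym a b c : half_angle a c b = half_angle a b c.
Proof.
unfold half_angle, inradius; replace (a + c + b) with (a + b + c) by ring.
now replace (a * c * b) with (a * b * c) by ring.
Qed.

Lemma half_angle_lt a b c c' : 0 < a -> 0 < b -> 0 < c -> c < c' ->
  half_angle a b c < half_angle a b c'.
Proof.
intros; apply atan_increasing, Rmult_lt_compat_r; [now apply Rinv_0_lt_compat|].
apply sqrt_lt_1; try (left; apply inradius_arg_pos; lra).
apply Rlt_0_minus.
replace (a * b * c' / (a + b + c') - a * b * c / (a + b + c)) with
  (a * b * (a + b) * (c' - c) / ((a + b + c') * (a + b + c))) by (field; lra).
apply Rdiv_lt_0_compat; [|nra].
repeat apply Rmult_lt_0_compat; lra.
Qed.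

(** The tangents [x = r / a], [y = r / b], [z = r / c] satisfy [x * y + y * z + z * x = 1], which
    turns into [atan (/ z) - atan x = atan y]. *)
Lemma half_angle_sum a b c : 0 < a -> 0 < b -> 0 < c ->
  half_angle a b c + half_angle b c a + half_angle c a b = PI / 2.
Proof.
intros Ha Hb Hc; unfold half_angle.
rewrite (inradius_rot a b c), <- (inradius_rot c a b).
assert (Hr := inradius_pos a b c Ha Hb Hc).
assert (H2 := inradius_sqr a b c Ha Hb Hc).
set (r := inradius a b c) in *.
assert (Hx : 0 < r / a) by now apply Rdiv_lt_0_compat.
assert (Hy : 0 < r / b) by now apply Rdiv_lt_0_compat.
assert (Hz : 0 < r / c) by now apply Rdiv_lt_0_compat.
assert (Hz' := Rinv_0_lt_compat _ Hz).
assert (B : forall x, 0 < x -> 0 < atan x < PI / 2).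
{ intros x Hx0; split; [|apply atan_bound].
  rewrite <- atan_0; now apply atan_increasing. }
assert (E := atan_inv _ Hz).
assert (F : atan_sub (/ (r / c)) (r / a) = r / b).
{ unfold atan_sub.
  replace ((/ (r / c) - r / a) / (1 + / (r / c) * (r / a)))
    with ((a * c - r * r) / (r * (a + c))) by (field; lra).
  rewrite H2. apply Rmult_eq_reg_r with (r * b * (a + c)).
  2: { apply Rgt_not_eq; repeat apply Rmult_lt_0_compat; lra. }
  transitivity (b * (a * c - a * b * c / (a + b + c))); [field; lra|].
  transitivity (r * r * (a + c)); [rewrite H2; field; lra|field; lra]. }
assert (G := atan_sub_correct (/ (r / c)) (r / a)).
rewrite F in G.
assert (B1 := B _ Hx); assert (B2 := B _ Hy); assert (B3 := B _ Hz').
rewrite G in E; try lra.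
assert (0 < / (r / c) * (r / a)) by nra. lra.
Qed.

(** Law of cosines for the sides [a + b] and [a + c] enclosing the angle and the opposite side
    [b + c]. *)
Lemma cos_double_half_angle a b c : 0 < a -> 0 < b -> 0 < c ->
  (a + b) * (a + c) * cos (2 * half_angle a b c) = a * a + a * b + a * c - b * c.
Proof.
intros Ha Hb Hc; rewrite cos_2a_cos; unfold half_angle; rewrite cos_atan.
set (x := inradius a b c / a).
assert (Hx : 1 + Rsqr x = (a + b) * (a + c) / (a * (a + b + c))).
{ unfold x, Rsqr; replace (inradius a b c / a * (inradius a b c / a))
    with (inradius a b c * inradius a b c / (a * a)) by (field; lra).
  rewrite inradius_sqr by easy; field; lra. }
assert (P : 0 < 1 + Rsqr x) by (assert (H := Rle_0_sqr x); lra).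
replace (2 * (1 / sqrt (1 + Rsqr x)) * (1 / sqrt (1 + Rsqr x)) - 1)
  with (2 / (sqrt (1 + Rsqr x) * sqrt (1 + Rsqr x)) - 1).
2: { field; apply Rgt_not_eq, sqrt_lt_R0, P. }
rewrite sqrt_sqrt, Hx by lra; field; repeat split; lra.
Qed.

(** * Variation of the angles and energy of one triangle *)

(** Here [wa], [wb], [wc] are logarithmic derivatives of the radii. Only their differences enter,
    because the angle is invariant under scaling. *)
Lemma is_derive_half_angle (fa fb fc : R -> R) (t wa wb wc : R) :
  0 < fa t -> 0 < fb t -> 0 < fc t ->
  is_derive fa t (fa t * wa) -> is_derive fb t (fb t * wb) ->
  is_derive fc t (fc t * wc) ->
  is_derive (fun s => half_angle (fa s) (fb s) (fc s)) t
    (inradius (fa t) (fb t) (fc t) / (2 * (fa t + fb t)) * (wb - wa) +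
     inradius (fa t) (fb t) (fc t) / (2 * (fa t + fc t)) * (wc - wa)).
Proof.
intros Ha Hb Hc Da Db Dc.
assert (Hr := inradius_pos _ _ _ Ha Hb Hc).
assert (H2 := inradius_sqr _ _ _ Ha Hb Hc).
assert (Hp := inradius_arg_pos _ _ _ Ha Hb Hc).
assert (D : is_derive (fun s => fa s * fb s * fc s / (fa s + fb s + fc s)) t
  (fa t * fb t * fc t / (fa t + fb t + fc t) *
   (wa + wb + wc - (fa t * wa + fb t * wb + fc t * wc) / (fa t + fb t + fc t)))).
{ auto_derive.
  - repeat split; try (eexists; eassumption); lra.
  - replace (Derive (fun x : R => fa x) t) with (fa t * wa)
      by now symmetry; apply is_derive_unique.
    replace (Derive (fun x : R => fb x) t) with (fb t * wb)
      by now symmetry; apply is_derive_unique.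
    replace (Derive (fun x : R => fc x) t) with (fc t * wc)
      by now symmetry; apply is_derive_unique.
    field; lra. }
assert (Dr := is_derive_sqrt _ _ _ D Hp).
assert (Dq := is_derive_div _ _ _ _ _ Dr Da (Rgt_not_eq _ _ Ha)).
assert (Dh := is_derive_comp _ _ _ _ _ (is_derive_atan _) Dq).
unfold half_angle; refine (eq_ind _ (is_derive _ t) Dh _ _).
fold (inradius (fa t) (fb t) (fc t)).
set (r := inradius (fa t) (fb t) (fc t)) in *.
unfold scal; simpl; unfold mult; simpl.
rewrite <- H2.
set (a := fa t) in *; set (b := fb t) in *; set (c := fc t) in *.
(* In this form [1 + Rsqr (r / a)] factors as [(a + b) * (a + c) / (a * (a + b + c))], the source of
   the denominators [a + b] and [a + c]. *)
replace (Rsqr (r / a)) with (b * c / (a * (a + b + c))).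
2: { unfold Rsqr; replace (r / a * (r / a)) with (r * r / (a * a)) by (field; lra).
     rewrite H2; field; lra. }
field; repeat split; try lra; try nra.
Qed.

Lemma conductance_bound a b c : 0 < a -> 0 < b -> 0 < c ->
  0 < inradius a b c / (2 * (a + b)) <= / 4.
Proof.
intros Ha Hb Hc; split.
- apply Rdiv_lt_0_compat; [now apply inradius_pos|lra].
- assert (H := inradius_le a b c Ha Hb Hc).
  apply Rle_div_l; lra.
Qed.

Definition half_angle_change (a b c wa wb wc : R) : R :=
  half_angle (a * exp wa) (b * exp wb) (c * exp wc) - half_angle a b c.

(** The radii move along [a * exp (t * wa)] and so on. The inradius is symmetric, so an edge has the
    same coefficient seen from both ends, and the derivative of the pairing is minus a Dirichlet
    form. The mean value theorem is applied to the whole pairing, so one [t] yields all three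
    conductances. *)
Lemma half_angle_change_pairing a b c wa wb wc pa pb pc :
  0 < a -> 0 < b -> 0 < c ->
  exists kab kbc kca : R,
    0 < kab <= / 4 /\ 0 < kbc <= / 4 /\ 0 < kca <= / 4 /\
    pa * half_angle_change a b c wa wb wc +
    pb * half_angle_change b c a wb wc wa +
    pc * half_angle_change c a b wc wa wb =
    - (kab * ((pa - pb) * (wa - wb)) + kbc * ((pb - pc) * (wb - wc)) +
       kca * ((pc - pa) * (wc - wa))).
Proof.
intros Ha Hb Hc.
pose (f := fun (r w t : R) => r * exp (t * w)).
assert (fpos : forall r w t, 0 < r -> 0 < f r w t).
{ intros r w t Hr; apply Rmult_lt_0_compat; [easy|apply exp_pos]. }
assert (fder : forall r w t, is_derive (f r w) t (f r w t * w)).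
{ intros r w t; unfold f; auto_derive; [easy|ring]. }
pose (g := fun t => pa * half_angle (f a wa t) (f b wb t) (f c wc t) +
  pb * half_angle (f b wb t) (f c wc t) (f a wa t) +
  pc * half_angle (f c wc t) (f a wa t) (f b wb t)).
pose (k := fun t x y => inradius (f a wa t) (f b wb t) (f c wc t) / (2 * (x + y))).
pose (g' := fun t => - (
   k t (f a wa t) (f b wb t) * ((pa - pb) * (wa - wb)) +
   k t (f b wb t) (f c wc t) * ((pb - pc) * (wb - wc)) +
   k t (f c wc t) (f a wa t) * ((pc - pa) * (wc - wa)))).
assert (gder : forall t, is_derive g t (g' t)).
{ intro t.
  assert (Pa := fpos a wa t Ha); assert (Pb := fpos b wb t Hb).
  assert (Pc := fpos c wc t Hc).
  assert (Da := is_derive_half_angle _ _ _ t _ _ _ Pa Pb Pc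
    (fder _ _ _) (fder _ _ _) (fder _ _ _)).
  assert (Db := is_derive_half_angle _ _ _ t _ _ _ Pb Pc Pa
    (fder _ _ _) (fder _ _ _) (fder _ _ _)).
  assert (Dc := is_derive_half_angle _ _ _ t _ _ _ Pc Pa Pb
    (fder _ _ _) (fder _ _ _) (fder _ _ _)).
  refine (eq_ind _ (is_derive g t) (is_derive_plus _ _ _ _ _
     (is_derive_plus _ _ _ _ _ (is_derive_scal _ _ pa _ Da)
        (is_derive_scal _ _ pb _ Db)) (is_derive_scal _ _ pc _ Dc)) _ _).
  unfold plus, g', k; simpl.
  rewrite (inradius_rot (f a wa t) (f b wb t) (f c wc t)).
  rewrite (inradius_rot (f b wb t) (f c wc t) (f a wa t)).
  rewrite (inradius_rot (f a wa t) (f b wb t) (f c wc t)).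
  field; lra. }
destruct (MVT_cor2 g g' 0 1 Rlt_0_1) as [t [Ht _]].
{ intros t _; now apply is_derive_Reals. }
assert (Pa := fpos a wa t Ha); assert (Pb := fpos b wb t Hb).
assert (Pc := fpos c wc t Hc).
exists (k t (f a wa t) (f b wb t)), (k t (f b wb t) (f c wc t)),
  (k t (f c wc t) (f a wa t)).
split; [now apply conductance_bound|].
split; [unfold k; rewrite <- inradius_rot; now apply conductance_bound|].
split; [unfold k; rewrite inradius_rot; now apply conductance_bound|].
transitivity (g 1 - g 0).
- unfold g, f, half_angle_change.
  now rewrite !Rmult_0_l, !Rmult_1_l, exp_0, !Rmult_1_r; ring.
- rewrite Ht; unfold g'; ring.
Qed.

(* Ground-state transform: [eta_i^2 / W_i] as a test function against [W]. *)
Lemma edge_energy_le (Wi Wj x y : R) : 0 < Wi -> 0 < Wj ->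
  (x * x / Wi - y * y / Wj) * (Wi - Wj) <= (x - y) * (x - y).
Proof.
intros Hi Hj; apply Rminus_le_0.
replace ((x - y) * (x - y) - (x * x / Wi - y * y / Wj) * (Wi - Wj))
  with (Rsqr (x * Wj - y * Wi) / (Wi * Wj)) by (unfold Rsqr; field; lra).
apply Rdiv_le_0_compat; [apply Rle_0_sqr|nra].
Qed.

(** Each edge term is bounded by [edge_energy_le], with the conductance relaxed from 1/4 to 1. The
    shift [s] cancels in the differences. *)
Lemma triangle_energy_ge a b c Wa Wb Wc s x y z :
  0 < a -> 0 < b -> 0 < c -> 0 < Wa -> 0 < Wb -> 0 < Wc ->
  - ((x - y) * (x - y) + (y - z) * (y - z) + (z - x) * (z - x)) <=
    x * x / Wa * half_angle_change a b c (Wa + s) (Wb + s) (Wc + s) +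
    y * y / Wb * half_angle_change b c a (Wb + s) (Wc + s) (Wa + s) +
    z * z / Wc * half_angle_change c a b (Wc + s) (Wa + s) (Wb + s).
Proof.
intros Ha Hb Hc HWa HWb HWc.
destruct (half_angle_change_pairing a b c (Wa + s) (Wb + s) (Wc + s)
  (x * x / Wa) (y * y / Wb) (z * z / Wc) Ha Hb Hc)
  as (p & q & r & Hp & Hq & Hr & ->).
assert (E1 := edge_energy_le Wa Wb x y HWa HWb).
assert (E2 := edge_energy_le Wb Wc y z HWb HWc).
assert (E3 := edge_energy_le Wc Wa z x HWc HWa).
assert (S1 := Rle_0_sqr (x - y)); assert (S2 := Rle_0_sqr (y - z)).
assert (S3 := Rle_0_sqr (z - x)); unfold Rsqr in *.
replace (Wa + s - (Wb + s)) with (Wa - Wb) by ring.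
replace (Wb + s - (Wc + s)) with (Wb - Wc) by ring.
replace (Wc + s - (Wa + s)) with (Wc - Wa) by ring.
assert (K : forall k e f, 0 < k <= / 4 -> e <= f -> 0 <= f -> k * e <= f).
{ intros k e f Hk He Hf. apply Rle_trans with (k * f); nra. }
assert (F1 := K _ _ _ Hp E1 S1); assert (F2 := K _ _ _ Hq E2 S2).
assert (F3 := K _ _ _ Hr E3 S3). lra.
Qed.

(** Against the test function [/ W], each edge contributes the nonnegative term
    [k * (Wi - Wj)^2 / (Wi * Wj)], so a nonpositive total makes all of them vanish. *)
Lemma triangle_energy_one a b c Wa Wb Wc s :
  0 < a -> 0 < b -> 0 < c -> 0 < Wa -> 0 < Wb -> 0 < Wc ->
  / Wa * half_angle_change a b c (Wa + s) (Wb + s) (Wc + s) +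
  / Wb * half_angle_change b c a (Wb + s) (Wc + s) (Wa + s) +
  / Wc * half_angle_change c a b (Wc + s) (Wa + s) (Wb + s) <= 0 ->
  Wa = Wb /\ Wa = Wc.
Proof.
intros Ha Hb Hc HWa HWb HWc.
destruct (half_angle_change_pairing a b c (Wa + s) (Wb + s) (Wc + s)
  (/ Wa) (/ Wb) (/ Wc) Ha Hb Hc) as (p & q & r & Hp & Hq & Hr & ->).
assert (K : forall k u v, 0 < u -> 0 < v ->
  k * ((/ u - / v) * (u + s - (v + s))) = - (k / (u * v) * Rsqr (u - v))).
{ intros k u v Hu Hv; unfold Rsqr; field; lra. }
assert (N : forall k u v, 0 < k -> 0 < u -> 0 < v -> 0 <= k / (u * v) * Rsqr (u - v)).
{ intros k u v Hk Hu Hv; apply Rmult_le_pos; [|apply Rle_0_sqr].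
  apply Rdiv_le_0_compat; [lra|nra]. }
assert (Z : forall k u v, 0 < k -> 0 < u -> 0 < v ->
  k / (u * v) * Rsqr (u - v) <= 0 -> u = v).
{ intros k u v Hk Hu Hv H; apply Rminus_diag_uniq, Rsqr_0_uniq.
  apply Rle_antisym; [|apply Rle_0_sqr].
  apply Rmult_le_reg_l with (k / (u * v)); [apply Rdiv_lt_0_compat; nra|lra]. }
rewrite !K by easy; intro H.
assert (N1 := N p Wa Wb (proj1 Hp) HWa HWb).
assert (N2 := N q Wb Wc (proj1 Hq) HWb HWc).
assert (N3 := N r Wc Wa (proj1 Hr) HWc HWa).
split; [apply (Z p); lra|symmetry; apply (Z r); lra].
Qed.

(** * Finite sums over symmetric boxes *)

Fixpoint zsum (M : nat) (f : Z -> R) : R :=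
  match M with
  | O => f 0%Z
  | S N => zsum N f + f (Z.of_nat M) + f (- Z.of_nat M)%Z
  end.

Lemma zsum_le M f g : (forall k, f k <= g k) -> zsum M f <= zsum M g.
Proof.
intro H; induction M as [|M IH]; cbn [zsum]; [apply H|].
assert (H1 := H (Z.of_nat (S M))); assert (H2 := H (- Z.of_nat (S M))%Z); lra.
Qed.

Lemma zsum_ext M f g : (forall k, f k = g k) -> zsum M f = zsum M g.
Proof. intro H; apply Rle_antisym; apply zsum_le; intro; rewrite H; lra. Qed.

Lemma zsum_plus M f g : zsum M (fun k => f k + g k) = zsum M f + zsum M g.
Proof. induction M as [|M IH]; cbn [zsum]; [easy|rewrite IH; ring]. Qed.

Lemma zsum_scal M c f : zsum M (fun k => c * f k) = c * zsum M f.
Proof. induction M as [|M IH]; cbn [zsum]; [easy|rewrite IH; ring]. Qed.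

Lemma zsum_0 M : zsum M (fun _ => 0) = 0.
Proof. induction M as [|M IH]; cbn [zsum]; [easy|rewrite IH; ring]. Qed.

Lemma zsum_ge_term M f k : (forall j, 0 <= f j) ->
  (Z.abs k <= Z.of_nat M)%Z -> f k <= zsum M f.
Proof.
intros H; assert (H0 : forall N, 0 <= zsum N f).
{ intro N; rewrite <- (zsum_0 N); now apply zsum_le. }
induction M as [|M IH]; intro Hk.
- replace k with 0%Z by lia; apply Rle_refl.
- cbn [zsum].
  assert (H1 := H (Z.of_nat (S M))); assert (H2 := H (- Z.of_nat (S M))%Z).
  assert (H3 := H0 M).
  destruct (Z.eq_dec k (Z.of_nat (S M))) as [->|N1]; [lra|].
  destruct (Z.eq_dec k (- Z.of_nat (S M))) as [->|N2]; [lra|].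
  assert (f k <= zsum M f) by (apply IH; lia); lra.
Qed.

Lemma zsum_succ M f : zsum M (fun k => f (k + 1)%Z) =
  zsum M f + f (Z.of_nat M + 1)%Z - f (- Z.of_nat M)%Z.
Proof.
induction M as [|M IH]; cbn [zsum]; [cbn; ring|rewrite IH].
replace (- Z.of_nat (S M) + 1)%Z with (- Z.of_nat M)%Z by lia.
replace (Z.of_nat M + 1)%Z with (Z.of_nat (S M)) by lia; ring.
Qed.

(** The shift trades the end term at [- M] for one at [M + 1]. Vanishing at distance exactly [M],
    not only beyond it, is what removes the former. *)
Lemma zsum_shift M f : (forall k, (Z.of_nat M <= Z.abs k)%Z -> f k = 0) ->
  zsum M (fun k => f (k + 1)%Z) = zsum M f.
Proof. intro H; rewrite zsum_succ, !H by lia; ring. Qed.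

Definition zsum2 (M : nat) (F : Z -> Z -> R) : R :=
  zsum M (fun m => zsum M (F m)).

Lemma zsum2_ext M F G : (forall m n, F m n = G m n) -> zsum2 M F = zsum2 M G.
Proof. intro H; apply zsum_ext; intro m; now apply zsum_ext. Qed.

Lemma zsum2_plus M F G :
  zsum2 M (fun m n => F m n + G m n) = zsum2 M F + zsum2 M G.
Proof.
unfold zsum2; rewrite <- zsum_plus; apply zsum_ext; intro m; apply zsum_plus.
Qed.

Lemma zsum2_scal M c F : zsum2 M (fun m n => c * F m n) = c * zsum2 M F.
Proof.
unfold zsum2; rewrite <- zsum_scal; apply zsum_ext; intro m; apply zsum_scal.
Qed.

Lemma zsum2_0 M : zsum2 M (fun _ _ => 0) = 0.
Proof.
unfold zsum2; rewrite <- (zsum_0 M) at 1; apply zsum_ext; intro; apply zsum_0.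
Qed.

Lemma zsum2_ge_term M F m n : (forall i j, 0 <= F i j) ->
  (Z.abs m <= Z.of_nat M)%Z -> (Z.abs n <= Z.of_nat M)%Z ->
  F m n <= zsum2 M F.
Proof.
intros H Hm Hn; apply Rle_trans with (zsum M (F m)).
- now apply zsum_ge_term.
- apply (zsum_ge_term M (fun i => zsum M (F i))); [|easy].
  intro i; rewrite <- (zsum_0 M); now apply zsum_le.
Qed.

Lemma zsum2_shift_l M F :
  (forall m n, (Z.of_nat M <= Z.abs m)%Z -> F m n = 0) ->
  zsum2 M (fun m n => F (m + 1)%Z n) = zsum2 M F.
Proof.
intro H; apply (zsum_shift M (fun m => zsum M (F m))); intros m Hm.
rewrite <- (zsum_0 M); apply zsum_ext; intro n; now apply H.
Qed.

Lemma zsum2_shift_r M F :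
  (forall m n, (Z.of_nat M <= Z.abs n)%Z -> F m n = 0) ->
  zsum2 M (fun m n => F m (n + 1)%Z) = zsum2 M F.
Proof.
intro H; apply zsum_ext; intros m; apply zsum_shift; intros; now apply H.
Qed.

(** * Logarithmic growth of the inverse square sum over the plane *)

Lemma zsum_inv_sqr_le M a : 1 <= a ->
  zsum M (fun k => / ((a + IZR (Z.abs k)) * (a + IZR (Z.abs k)))) <= 3 / a.
Proof.
intro Ha.
(* This sharper bound survives the induction: the terms are compared with a telescoping series. *)
apply Rle_trans with (/ (a * a) + 2 * (/ a - / (a + INR M))).
- induction M as [|M IH]; cbn [zsum].
  + cbn; rewrite !Rplus_0_r; lra.
  + rewrite Z.abs_opp, !Z.abs_eq by lia; rewrite <- INR_IZR_INZ, S_INR.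
    assert (HM := pos_INR M).
    assert (H : / ((a + (INR M + 1)) * (a + (INR M + 1))) <=
                / (a + INR M) - / (a + (INR M + 1))).
    { replace (/ (a + INR M) - / (a + (INR M + 1))) with
        (/ ((a + INR M) * (a + (INR M + 1)))) by (field; lra).
      apply Rinv_le_contravar; nra. }
    lra.
- assert (HM := pos_INR M).
  assert (0 < / (a + INR M)) by (apply Rinv_0_lt_compat; lra).
  assert (/ (a * a) <= / a) by (apply Rinv_le_contravar; nra).
  unfold Rdiv; lra.
Qed.

Lemma ln_le_pred x : 0 < x -> ln x <= x - 1.
Proof.
intro H; assert (E := exp_ineq1_le (ln x)); rewrite exp_ln in E by easy; lra.
Qed.

Lemma zsum_inv_le M :
  zsum M (fun k => / (1 + IZR (Z.abs k))) <= 1 + 2 * ln (1 + INR M).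
Proof.
induction M as [|M IH]; cbn [zsum].
- cbn; rewrite !Rplus_0_r, ln_1; lra.
- rewrite Z.abs_opp, !Z.abs_eq by lia; rewrite <- INR_IZR_INZ, S_INR.
  assert (HM := pos_INR M).
  assert (H := ln_le_pred ((1 + INR M) / (1 + (INR M + 1)))).
  rewrite ln_div in H by lra.
  replace ((1 + INR M) / (1 + (INR M + 1)) - 1) with (- / (1 + (INR M + 1)))
    in H by (field; lra).
  enough (0 < (1 + INR M) / (1 + (INR M + 1))) by (specialize (H H0); lra).
  apply Rdiv_lt_0_compat; lra.
Qed.

Definition size (m n : Z) : R := 1 + IZR (Z.abs m) + IZR (Z.abs n).

(** Summing over [n] leaves at most [3 / (1 + |m|)], a harmonic series. That the growth is only
    logarithmic is the source of recurrence. *)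
Lemma zsum2_inv_size_sqr_le M :
  zsum2 M (fun m n => / (size m n * size m n)) <= 3 * (1 + 2 * ln (1 + INR M)).
Proof.
apply Rle_trans with (zsum M (fun m => 3 * / (1 + IZR (Z.abs m)))).
- apply zsum_le; intro m; apply zsum_inv_sqr_le.
  assert (0 <= IZR (Z.abs m)) by (apply IZR_le; lia); lra.
- rewrite zsum_scal; assert (H := zsum_inv_le M); lra.
Qed.

(** * The logarithmic cutoff *)

Definition clip (x : R) : R := Rmax 0 (Rmin 1 x).

Lemma clip_lipschitz x y : Rabs (clip x - clip y) <= Rabs (x - y).
Proof.
unfold clip, Rmax, Rmin, Rabs.
repeat (destruct Rle_dec || destruct Rcase_abs); lra.
Qed.

(** For [L > 0], equal to 1 up to [t = A], then affine in [ln t], and 0 from [t = A * exp L] on. *)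
Definition log_cutoff (A L t : R) : R := clip (1 - (ln t - ln A) / L).

Lemma log_cutoff_one A L t : 0 < L -> 0 < t -> t <= A -> log_cutoff A L t = 1.
Proof.
intros HL Ht HA; assert (H := ln_le _ _ Ht HA).
assert (0 <= (ln A - ln t) / L) by (apply Rdiv_le_0_compat; lra).
replace ((ln A - ln t) / L) with (- ((ln t - ln A) / L)) in H0 by (field; lra).
unfold log_cutoff, clip; rewrite Rmin_left, Rmax_right; lra.
Qed.

Lemma log_cutoff_zero A L t : 0 < L -> 0 < A -> ln A + L <= ln t ->
  log_cutoff A L t = 0.
Proof.
intros HL HA Ht.
assert (1 <= (ln t - ln A) / L) by (apply Rle_div_r; lra).
unfold log_cutoff, clip; apply Rmax_left.
apply Rle_trans with (1 := Rmin_r _ _); lra.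
Qed.

(** The cutoff has slope at most [1 / (L * t)]. [T] is a common reference scale for both arguments:
    a step of length 2 at height at least [T / 3] changes [ln] by at most [6 / T]. *)
Lemma log_cutoff_diff A L T t t' : 0 < L -> 0 < T -> T <= 3 * t -> T <= 3 * t' ->
  Rabs (t - t') <= 2 ->
  (log_cutoff A L t - log_cutoff A L t') * (log_cutoff A L t - log_cutoff A L t')
    <= 36 * / (L * L) * / (T * T).
Proof.
intros HL HT Ht Ht' Htt.
assert (D : forall u v, T <= 3 * u -> T <= 3 * v -> Rabs (u - v) <= 2 ->
   ln u - ln v <= 6 / T).
{ intros u v Hu Hv Huv.
  assert (H := ln_le_pred (u / v)); rewrite ln_div in H by lra.
  assert (0 < u / v) by (apply Rdiv_lt_0_compat; lra).
  specialize (H H0); apply Rle_trans with (1 := H).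
  replace (u / v - 1) with ((u - v) / v) by (field; lra).
  apply Rle_div_l; [lra|].
  assert (2 <= 6 / T * v).
  { replace (6 / T * v) with (2 * (3 * v) / T) by (field; lra).
    apply Rle_div_r; lra. }
  assert (u - v <= Rabs (u - v)) by apply Rle_abs; lra. }
assert (Rabs (log_cutoff A L t - log_cutoff A L t') <= 6 / T / L).
{ apply Rle_trans with (1 := clip_lipschitz _ _).
  replace (1 - (ln t - ln A) / L - (1 - (ln t' - ln A) / L))
    with ((ln t' - ln t) / L) by (field; lra).
  unfold Rdiv at 1; rewrite Rabs_mult, (Rabs_right (/ L)).
  2: { apply Rle_ge; left; now apply Rinv_0_lt_compat. }
  apply Rmult_le_compat_r; [left; now apply Rinv_0_lt_compat|].
  assert (D1 := D _ _ Ht Ht' Htt); rewrite Rabs_minus_sym in Htt.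
  assert (D2 := D _ _ Ht' Ht Htt).
  apply Rabs_le; lra. }
replace (36 * / (L * L) * / (T * T)) with (Rsqr (6 / T / L))
  by (unfold Rsqr; field; lra).
fold (Rsqr (log_cutoff A L t - log_cutoff A L t')).
apply Rsqr_le_abs_1; apply Rle_trans with (1 := H), Rle_abs.
Qed.

(* Only half of the total angle at the vertex [(m, n)]. *)
Definition flower (r : Z -> Z -> R) (m n : Z) : R :=
  half_angle (r m n) (r (m + 1)%Z n) (r m (n + 1)%Z) +
  half_angle (r m n) (r m (n + 1)%Z) (r (m - 1)%Z (n + 1)%Z) +
  half_angle (r m n) (r (m - 1)%Z (n + 1)%Z) (r (m - 1)%Z n) +
  half_angle (r m n) (r (m - 1)%Z n) (r m (n - 1)%Z) +
  half_angle (r m n) (r m (n - 1)%Z) (r (m + 1)%Z (n - 1)%Z) +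
  half_angle (r m n) (r (m + 1)%Z (n - 1)%Z) (r (m + 1)%Z n).

Lemma size_IZR m n : size m n = IZR (1 + Z.abs m + Z.abs n).
Proof. unfold size; now rewrite !plus_IZR. Qed.

Lemma size_ge1 m n : 1 <= size m n.
Proof. rewrite size_IZR; apply IZR_le; lia. Qed.

(** The offsets in [{0, 1}] reach all vertices of the two triangles based at [(m, n)]. Each such
    vertex has size at least 1 and at least [size m n - 2], hence at least a third of [size m n]. *)
Lemma cutoff_edge A L m n i j i' j' : 0 < L ->
  (0 <= i <= 1)%Z -> (0 <= j <= 1)%Z -> (0 <= i' <= 1)%Z -> (0 <= j' <= 1)%Z ->
  let d := log_cutoff A L (size (m + i) (n + j)) -
           log_cutoff A L (size (m + i') (n + j')) in
  d * d <= 36 * / (L * L) * / (size m n * size m n).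
Proof.
intros HL Hi Hj Hi' Hj'; apply log_cutoff_diff; [easy| | | |].
- assert (H := size_ge1 m n); lra.
- rewrite !size_IZR, <- mult_IZR; apply IZR_le; lia.
- rewrite !size_IZR, <- mult_IZR; apply IZR_le; lia.
- rewrite !size_IZR, <- minus_IZR, <- abs_IZR; apply IZR_le; lia.
Qed.

(** * Liouville theorem for the angle equation *)

Section Liouville.

(** The second family of radii is [r * exp (W + s)]: the constant [s] is split off from the
    logarithmic ratio so that [W] is positive. *)
Variables (r W : Z -> Z -> R) (s : R).
Hypothesis r_pos : forall m n, 0 < r m n.
Hypothesis W_pos : forall m n, 0 < W m n.

Let chg m n m' n' m'' n'' :=
  half_angle_change (r m n) (r m' n') (r m'' n'')
    (W m n + s) (W m' n' + s) (W m'' n'' + s).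

(** Every face is a translate of one of two triangles. [up] and [down] pair the test function with
    the angle changes at the three corners of such a face. *)
Let up (psi : Z -> Z -> R) m n :=
  psi m n * chg m n (m + 1) n m (n + 1) +
  psi (m + 1)%Z n * chg (m + 1) n m (n + 1) m n +
  psi m (n + 1)%Z * chg m (n + 1) m n (m + 1) n.

Let down (psi : Z -> Z -> R) m n :=
  psi (m + 1)%Z n * chg (m + 1) n (m + 1) (n + 1) m (n + 1) +
  psi (m + 1)%Z (n + 1)%Z * chg (m + 1) (n + 1) m (n + 1) (m + 1) n +
  psi m (n + 1)%Z * chg m (n + 1) (m + 1) n (m + 1) (n + 1).

(** Regrouping the sum by vertices instead of faces: each vertex collects [psi] times the change of
    its whole flower, which is 0. The vanishing of [psi] near the boundary of the box makes the
    shifts exact. *)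
Lemma triangle_sum_eq0 M (psi : Z -> Z -> R) :
  (forall m n, flower (fun m n => r m n * exp (W m n + s)) m n = flower r m n) ->
  (forall m n, (Z.of_nat M <= Z.abs m \/ Z.of_nat M <= Z.abs n)%Z ->
    psi m n = 0) ->
  zsum2 M (fun m n => up psi m n + down psi m n) = 0.
Proof.
intros Heq Hpsi.
(* The six angles at [(m, n)]: [F1], [F2], [F3] lie in [up] triangles and [F4], [F5], [F6] in [down]
   triangles. *)
pose (F1 := fun m n => psi m n * chg m n (m + 1) n m (n + 1)).
pose (F2 := fun m n => psi m n * chg m n (m - 1) (n + 1) (m - 1) n).
pose (F3 := fun m n => psi m n * chg m n m (n - 1) (m + 1) (n - 1)).
pose (F4 := fun m n => psi m n * chg m n m (n + 1) (m - 1) (n + 1)).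
pose (F5 := fun m n => psi m n * chg m n (m - 1) n m (n - 1)).
pose (F6 := fun m n => psi m n * chg m n (m + 1) (n - 1) (m + 1) n).
assert (V : forall c : Z -> Z -> R, forall m n,
  (Z.of_nat M <= Z.abs m \/ Z.of_nat M <= Z.abs n)%Z -> psi m n * c m n = 0).
{ intros c m n H; rewrite (Hpsi m n H); ring. }
rewrite (zsum2_ext M _ (fun m n => F1 m n + (F2 (m + 1)%Z n + (F3 m (n + 1)%Z +
  (F4 (m + 1)%Z n + (F5 (m + 1)%Z (n + 1)%Z + F6 m (n + 1)%Z)))))).
2: { intros m n; unfold up, down, F1, F2, F3, F4, F5, F6.
     rewrite !Z.add_simpl_r; ring. }
rewrite !zsum2_plus.
rewrite (zsum2_shift_l M F2), (zsum2_shift_l M F4), (zsum2_shift_r M F3),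
  (zsum2_shift_r M F6), (zsum2_shift_r M (fun m n => F5 (m + 1)%Z n)),
  (zsum2_shift_l M F5) by
  (intros; apply (V (fun m n => chg _ _ _ _ _ _)); auto).
rewrite <- !zsum2_plus, <- (zsum2_0 M); apply zsum2_ext; intros m n.
transitivity (psi m n *
  (flower (fun m n => r m n * exp (W m n + s)) m n - flower r m n)).
- unfold F1, F2, F3, F4, F5, F6, chg, half_angle_change, flower; ring.
- rewrite Heq; ring.
Qed.

(* Recurrence of the lattice: with [ln (1 + M) = ln A + L], the bound on the
   right, an energy of the logarithmic cutoff, is [O (1 / L)]. *)
Lemma up_energy_le A L M m0 n0 : 0 < L -> 0 < A ->
  ln (1 + INR M) = ln A + L ->
  size m0 n0 + 1 <= A ->
  (forall m n, flower (fun m n => r m n * exp (W m n + s)) m n = flower r m n) ->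
  up (fun m n => / W m n) m0 n0 <= 648 * (1 + 2 * ln (1 + INR M)) / (L * L).
Proof.
intros HL HA HM Hsize Heq.
assert (HLL : 0 < L * L) by nra.
pose (eta := fun m n => log_cutoff A L (size m n)).
pose (psi := fun m n => eta m n * eta m n / W m n).
assert (LM : forall m n, (Z.of_nat M <= Z.abs m \/ Z.of_nat M <= Z.abs n)%Z ->
   eta m n = 0).
{ intros m n H; apply log_cutoff_zero; [easy|easy|].
  rewrite <- HM; apply ln_le; [assert (H0 := pos_INR M); lra|].
  rewrite size_IZR, INR_IZR_INZ, <- plus_IZR; apply IZR_le; lia. }
assert (Hsum := triangle_sum_eq0 M psi Heq).
(* The vanishing sum over all triangles is added to the right-hand side. *)
rewrite <- (Rplus_0_l (_ / _)), <- Hsum.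
2: { intros m n H; unfold psi; rewrite LM by easy; unfold Rdiv; ring. }
(* Two triangles with three edges each, at 36 per edge, give 216: an edge costs [B / 6] and a
   triangle [B / 2]. *)
pose (B := fun m n => 216 / (L * L) * / (size m n * size m n)).
assert (HB : zsum2 M B <= 648 * (1 + 2 * ln (1 + INR M)) / (L * L)).
{ unfold B; rewrite zsum2_scal.
  assert (H := zsum2_inv_size_sqr_le M).
  replace (648 * (1 + 2 * ln (1 + INR M)) / (L * L)) with
    (216 / (L * L) * (3 * (1 + 2 * ln (1 + INR M)))) by (field; lra).
  apply Rmult_le_compat_l; [|easy].
  apply Rdiv_le_0_compat; lra. }
apply Rle_trans with (2 := Rplus_le_compat_l _ _ _ HB).
rewrite <- zsum2_plus.
assert (E : forall m n i j i' j', (0 <= i <= 1)%Z -> (0 <= j <= 1)%Z ->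
  (0 <= i' <= 1)%Z -> (0 <= j' <= 1)%Z ->
  (eta (m + i)%Z (n + j)%Z - eta (m + i')%Z (n + j')%Z) *
  (eta (m + i)%Z (n + j)%Z - eta (m + i')%Z (n + j')%Z) <= B m n / 6).
{ intros m n i j i' j' Hi Hj Hi' Hj'.
  apply Rle_trans with (1 := cutoff_edge A L m n i j i' j' HL Hi Hj Hi' Hj').
  unfold B; apply Req_le; field.
  assert (H := size_ge1 m n); lra. }
assert (Up : forall m n, - (B m n / 2) <= up psi m n).
{ intros m n; unfold up, psi, chg.
  refine (Rle_trans _ _ _ _ (triangle_energy_ge _ _ _ _ _ _ s _ _ _
     (r_pos _ _) (r_pos _ _) (r_pos _ _) (W_pos _ _) (W_pos _ _) (W_pos _ _))).
  assert (E1 := E m n 0%Z 0%Z 1%Z 0%Z); assert (E2 := E m n 1%Z 0%Z 0%Z 1%Z).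
  assert (E3 := E m n 0%Z 1%Z 0%Z 0%Z); rewrite !Z.add_0_r in *.
  assert (E1' := E1 ltac:(lia) ltac:(lia) ltac:(lia) ltac:(lia)).
  assert (E2' := E2 ltac:(lia) ltac:(lia) ltac:(lia) ltac:(lia)).
  assert (E3' := E3 ltac:(lia) ltac:(lia) ltac:(lia) ltac:(lia)).
  lra. }
assert (Down : forall m n, - (B m n / 2) <= down psi m n).
{ intros m n; unfold down, psi, chg.
  refine (Rle_trans _ _ _ _ (triangle_energy_ge _ _ _ _ _ _ s _ _ _
     (r_pos _ _) (r_pos _ _) (r_pos _ _) (W_pos _ _) (W_pos _ _) (W_pos _ _))).
  assert (E1 := E m n 1%Z 0%Z 1%Z 1%Z); assert (E2 := E m n 1%Z 1%Z 0%Z 1%Z).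
  assert (E3 := E m n 0%Z 1%Z 1%Z 0%Z); rewrite !Z.add_0_r in *.
  assert (E1' := E1 ltac:(lia) ltac:(lia) ltac:(lia) ltac:(lia)).
  assert (E2' := E2 ltac:(lia) ltac:(lia) ltac:(lia) ltac:(lia)).
  assert (E3' := E3 ltac:(lia) ltac:(lia) ltac:(lia) ltac:(lia)).
  lra. }
assert (AM : A <= 1 + INR M).
{ apply Rnot_lt_le; intro H; apply ln_increasing in H; [lra|].
  assert (H0 := pos_INR M); lra. }
assert (HM0 : (1 + Z.abs m0 + Z.abs n0 <= Z.of_nat M)%Z).
{ apply le_IZR; rewrite <- size_IZR, <- INR_IZR_INZ; lra. }
(* All summands are nonnegative, so the one at [(m0, n0)], where the cutoff is 1, is at most the
   total. *)
assert (NN : forall i j, 0 <= up psi i j + down psi i j + B i j).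
{ intros i j; specialize (Up i j); specialize (Down i j); lra. }
apply Rle_trans with (2 := zsum2_ge_term M _ m0 n0 NN ltac:(lia) ltac:(lia)).
assert (One : forall i j, (0 <= i)%Z -> (0 <= j)%Z -> (i + j <= 1)%Z ->
  psi (m0 + i)%Z (n0 + j)%Z = / W (m0 + i)%Z (n0 + j)%Z).
{ intros i j Hi Hj Hij; unfold psi, eta; rewrite log_cutoff_one; [field|easy| |].
  - apply Rgt_not_eq, W_pos.
  - assert (H := size_ge1 (m0 + i) (n0 + j)); lra.
  - apply Rle_trans with (2 := Hsize).
    rewrite !size_IZR, <- plus_IZR; apply IZR_le; lia. }
replace (up psi m0 n0) with (up (fun m n => / W m n) m0 n0).
- assert (H := Down m0 n0).
  assert (0 <= B m0 n0).
  { unfold B; apply Rmult_le_pos; [apply Rdiv_le_0_compat; lra|].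
    left; apply Rinv_0_lt_compat; assert (S := size_ge1 m0 n0).
    apply Rmult_lt_0_compat; lra. }
  lra.
- assert (O1 := One 0%Z 0%Z ltac:(lia) ltac:(lia) ltac:(lia)).
  assert (O2 := One 1%Z 0%Z ltac:(lia) ltac:(lia) ltac:(lia)).
  assert (O3 := One 0%Z 1%Z ltac:(lia) ltac:(lia) ltac:(lia)).
  rewrite !Z.add_0_r in *; unfold up; now rewrite O1, O2, O3.
Qed.

(** The energy [d] of a single triangle for the test function [/ W] is bounded by a quantity of
    order [1 / L] with [L] arbitrarily large. Hence [d <= 0], and [triangle_energy_one] applies. *)
Lemma liouville :
  (forall m n, flower (fun m n => r m n * exp (W m n + s)) m n = flower r m n) ->
  forall m n, W m n = W (m + 1)%Z n /\ W m n = W m (n + 1)%Z.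
Proof.
intros Heq m n.
apply (triangle_energy_one (r m n) (r (m + 1)%Z n) (r m (n + 1)%Z) _ _ _ s);
  try apply r_pos; try apply W_pos.
change (up (fun m n => / W m n) m n <= 0).
apply Rnot_lt_le; intro Hd; set (d := up _ m n) in Hd.
pose (A := size m n + 1).
assert (HA : 2 <= A) by (assert (H := size_ge1 m n); unfold A; lra).
(* For [L >= 1] the numerator of the energy bound is at most [K * L], so [d * L <= K]; taking
   [L > 1 + K / d] contradicts this. *)
pose (K := 648 * (3 + 2 * ln A)).
assert (HlA : 0 < ln A) by (rewrite <- ln_1; apply ln_increasing; lra).
destruct (INR_unbounded (A * exp (1 + K / d))) as [M HM].
assert (HK : 0 < K / d) by (apply Rdiv_lt_0_compat; unfold K; lra).
pose (L := ln (1 + INR M) - ln A).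
assert (HL : 1 + K / d < L).
{ unfold L; apply Rlt_minus_r; rewrite <- (ln_exp (1 + K / d)), Rplus_comm.
  rewrite <- ln_mult; [|lra|apply exp_pos].
  apply ln_increasing; [|lra].
  apply Rmult_lt_0_compat; [lra|apply exp_pos]. }
assert (H := up_energy_le A L M m n ltac:(lra) ltac:(lra)
  ltac:(unfold L; ring) ltac:(unfold A; lra) Heq).
fold d in H; apply Rle_div_r in H; [|nra].
replace (ln (1 + INR M)) with (L + ln A) in H by (unfold L; ring).
assert (K < L * d).
{ apply Rlt_div_l; lra. }
assert (648 * (1 + 2 * (L + ln A)) <= K * L) by (unfold K; nra).
nra.
Qed.

End Liouville.

(** * Plane geometry of triangles and sectors *)

Lemma Cmod_sqr z : Cmod z * Cmod z = fst z * fst z + snd z * snd z.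
Proof.
unfold Cmod; rewrite sqrt_sqrt; [ring|].
assert (H1 := pow2_ge_0 (fst z)); assert (H2 := pow2_ge_0 (snd z)); lra.
Qed.

Lemma counterclockwiseE a b c : counterclockwise a b c <->
  0 < (fst b - fst a) * (snd c - snd a) - (snd b - snd a) * (fst c - fst a).
Proof.
unfold counterclockwise, Im, Cmult, Cconj, Cminus, Cplus, Copp; simpl.
match goal with |- 0 < ?x <-> 0 < ?y => replace x with y by ring end; easy.
Qed.

(** Barycentric coordinates are affine in the point, so positive ones stay nonnegative on a small
    neighborhood. *)
Lemma triangle_interior (a b c : C) (s t u : R) :
  counterclockwise a b c -> 0 < s -> 0 < t -> 0 < u -> s + t + u = 1 ->
  Cinterior (Defs.triangle a b c)
    (s * fst a + t * fst b + u * fst c, s * snd a + t * snd b + u * snd c)%R.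
Proof.
rewrite counterclockwiseE.
destruct a as [ax ay], b as [bx by'], c as [cx cy]; simpl.
set (D := (bx - ax) * (cy - ay) - (by' - ay) * (cx - ax)).
intros HD Hs Ht Hu Hstu.
pose (K := Rabs (cy - ay) + Rabs (cx - ax) + Rabs (bx - ax) + Rabs (by' - ay)).
assert (HK : 0 <= K).
{ unfold K; assert (H1 := Rabs_pos (cy - ay)); assert (H2 := Rabs_pos (cx - ax)).
  assert (H3 := Rabs_pos (bx - ax)); assert (H4 := Rabs_pos (by' - ay)); lra. }
pose (m := Rmin s (Rmin t u)).
assert (Hm : 0 < m /\ m <= s /\ m <= t /\ m <= u).
{ unfold m, Rmin; repeat destruct Rle_dec; lra. }
(* [D] is twice the area and [m] the least coordinate. The factor 2 is there because the first
   coordinate absorbs the errors of both others. *)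
assert (He : 0 < m * D / (2 * (K + 1))).
{ apply Rdiv_lt_0_compat; [nra|lra]. }
exists (mkposreal _ He); intros [x y] [Hx Hy]; simpl in Hx, Hy.
change (Rabs (x - (s * ax + t * bx + u * cx)) < m * D / (2 * (K + 1))) in Hx.
change (Rabs (y - (s * ay + t * by' + u * cy)) < m * D / (2 * (K + 1))) in Hy.
set (dx := x - _) in Hx; set (dy := y - _) in Hy.
set (e := m * D / (2 * (K + 1))) in *.
assert (HeK : 2 * (e * K) < m * D).
{ replace (m * D) with (2 * (e * (K + 1))) by (unfold e; field; lra). lra. }
assert (B : forall p q, Rabs p + Rabs q <= K ->
  Rabs (dx * p + dy * q) <= e * K).
{ intros p q Hpq; apply Rle_trans with (1 := Rabs_triang _ _).
  rewrite !Rabs_mult.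
  assert (H1 := Rabs_pos p); assert (H2 := Rabs_pos q).
  assert (Rabs dx * Rabs p <= e * Rabs p) by (apply Rmult_le_compat_r; lra).
  assert (Rabs dy * Rabs q <= e * Rabs q) by (apply Rmult_le_compat_r; lra).
  apply Rle_trans with (e * (Rabs p + Rabs q)); [lra|].
  apply Rmult_le_compat_l; lra. }
assert (P1 := Rabs_pos (cy - ay)); assert (P2 := Rabs_pos (cx - ax)).
assert (P3 := Rabs_pos (bx - ax)); assert (P4 := Rabs_pos (by' - ay)).
assert (B1 := B (cy - ay) (- (cx - ax))
  ltac:(rewrite Rabs_Ropp; unfold K; lra)).
assert (B2 := B (- (by' - ay)) (bx - ax)
  ltac:(rewrite Rabs_Ropp; unfold K; lra)).
apply Rabs_le_between in B1, B2.
set (dt := dx * (cy - ay) + dy * - (cx - ax)) in B1.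
set (du := dx * - (by' - ay) + dy * (bx - ax)) in B2.
assert (Q : forall z w, m <= z -> - m * D < w -> 0 <= z + w / D).
{ intros z w Hz Hw; assert (- m < w / D) by now apply Rlt_div_r. lra. }
exists (s + (- dt - du) / D), (t + dt / D), (u + du / D).
split; [apply Q; lra|].
split; [apply Q; lra|].
split; [apply Q; lra|].
split; [replace 1 with (s + t + u) by lra; field; lra|].
unfold Cplus, Cmult, RtoC; simpl.
assert (Hs1 : s = 1 - t - u) by lra.
f_equal; unfold dt, du, dx, dy; rewrite Hs1; unfold D; field; fold D; lra.
Qed.

Section Corner.

Variables z0 z1 z2 : C.
(** Points are written [z0 + p * e * exp (i * alpha)] in coordinates, with [alpha] a real number
    that is not reduced modulo [2 * PI]. *)
Variables e : C.

Lemma sector_interior (p q alpha beta psi : R) :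
  counterclockwise z0 z1 z2 -> 0 < p -> 0 < q ->
  alpha < psi < beta -> beta < alpha + PI ->
  fst z1 = fst z0 + p * (fst e * cos alpha - snd e * sin alpha) ->
  snd z1 = snd z0 + p * (fst e * sin alpha + snd e * cos alpha) ->
  fst z2 = fst z0 + q * (fst e * cos beta - snd e * sin beta) ->
  snd z2 = snd z0 + q * (fst e * sin beta + snd e * cos beta) ->
  exists delta, 0 < delta /\ forall s, 0 < s < delta ->
    Cinterior (Defs.triangle z0 z1 z2)
      (fst z0 + s * (fst e * cos psi - snd e * sin psi),
       snd z0 + s * (fst e * sin psi + snd e * cos psi))%R.
Proof.
intros Hccw Hp Hq Hpsi Hb H1x H1y H2x H2y.
assert (S1 : 0 < sin (beta - psi)) by (apply sin_gt_0; lra).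
assert (S2 : 0 < sin (psi - alpha)) by (apply sin_gt_0; lra).
assert (S : 0 < sin (beta - alpha)) by (apply sin_gt_0; lra).
(* From [sin (beta - alpha) * exp (i * psi) = sin (beta - psi) * exp (i * alpha) + sin (psi - alpha)
   * exp (i * beta)]. *)
pose (t := sin (beta - psi) / (p * sin (beta - alpha))).
pose (u := sin (psi - alpha) / (q * sin (beta - alpha))).
assert (Ht : 0 < t) by (apply Rdiv_lt_0_compat; nra).
assert (Hu : 0 < u) by (apply Rdiv_lt_0_compat; nra).
exists (/ (t + u)); split; [apply Rinv_0_lt_compat; lra|].
intros s [Hs Hs'].
assert (Hstu : s * (t + u) < 1).
{ apply Rmult_lt_reg_r with (/ (t + u)); [apply Rinv_0_lt_compat; lra|].
  field_simplify; [|lra|lra]. unfold Rdiv; lra. }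
assert (Ec : t * p * cos alpha + u * q * cos beta = cos psi).
{ transitivity ((sin (beta - psi) * cos alpha + sin (psi - alpha) * cos beta) /
    sin (beta - alpha)); [unfold t, u; field; lra|].
  apply Rmult_eq_reg_r with (sin (beta - alpha)); [|lra].
  field_simplify; [|lra]. rewrite !sin_minus; ring. }
assert (Es : t * p * sin alpha + u * q * sin beta = sin psi).
{ transitivity ((sin (beta - psi) * sin alpha + sin (psi - alpha) * sin beta) /
    sin (beta - alpha)); [unfold t, u; field; lra|].
  apply Rmult_eq_reg_r with (sin (beta - alpha)); [|lra].
  field_simplify; [|lra]. rewrite !sin_minus; ring. }
assert (T := triangle_interior z0 z1 z2 (1 - s * t - s * u) (s * t) (s * u)
  Hccw ltac:(lra) ltac:(nra) ltac:(nra) ltac:(ring)).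
refine (eq_ind _ (Cinterior (Defs.triangle z0 z1 z2)) T _ _).
rewrite H1x, H1y, H2x, H2y, <- Ec, <- Es; f_equal; ring.
Qed.

(** The side lengths fix the scalar product of the two sides at [z0], and the orientation makes
    their cross product positive; together these determine the second side from the first. *)
Lemma corner_rotation (a b c phi : R) : 0 < a -> 0 < b -> 0 < c ->
  Cmod (Cminus z0 z1) = a + b -> Cmod (Cminus z1 z2) = b + c ->
  Cmod (Cminus z2 z0) = c + a -> counterclockwise z0 z1 z2 ->
  fst z1 = fst z0 + (a + b) * (fst e * cos phi - snd e * sin phi) ->
  snd z1 = snd z0 + (a + b) * (fst e * sin phi + snd e * cos phi) ->
  let phi' := phi + 2 * half_angle a b c in
  fst z2 = fst z0 + (a + c) * (fst e * cos phi' - snd e * sin phi') /\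
  snd z2 = snd z0 + (a + c) * (fst e * sin phi' + snd e * cos phi').
Proof.
intros Ha Hb Hc M01 M12 M20; rewrite counterclockwiseE; intros Hccw Hx Hy.
assert (N01 := Cmod_sqr (Cminus z0 z1)); rewrite M01 in N01.
assert (N12 := Cmod_sqr (Cminus z1 z2)); rewrite M12 in N12.
assert (N20 := Cmod_sqr (Cminus z2 z0)); rewrite M20 in N20.
unfold Cminus, Cplus, Copp in *; simpl in *.
assert (HC := cos_double_half_angle a b c Ha Hb Hc).
assert (HB := half_angle_bound a b c Ha Hb Hc).
assert (HS : 0 < sin (2 * half_angle a b c)) by (apply sin_gt_0; lra).
assert (H1 := sin2_cos2 (2 * half_angle a b c)); unfold Rsqr in H1.
rewrite cos_plus, sin_plus.
set (co := cos (2 * half_angle a b c)) in *.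
set (si := sin (2 * half_angle a b c)) in *.
set (vx := fst z2 - fst z0) in *; set (vy := snd z2 - snd z0) in *.
pose (ux := fst z1 - fst z0); pose (uy := snd z1 - snd z0).
fold ux uy in Hccw.
assert (U2 : ux * ux + uy * uy = (a + b) * (a + b)) by (unfold ux, uy; lra).
assert (V2 : vx * vx + vy * vy = (a + c) * (a + c)) by (unfold vx, vy; lra).
assert (UV : ux * vx + uy * vy = (a + b) * (a + c) * co).
{ rewrite HC; unfold ux, uy, vx, vy in *; lra. }
(* Lagrange's identity gives the square of the cross product; both sides are positive. *)
assert (UxV : ux * vy - uy * vx = (a + b) * (a + c) * si).
{ apply Rsqr_inj; [lra| |unfold Rsqr].
  - left; repeat apply Rmult_lt_0_compat; lra.
  - replace ((ux * vy - uy * vx) * (ux * vy - uy * vx)) with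
      ((ux * ux + uy * uy) * (vx * vx + vy * vy) -
       (ux * vx + uy * vy) * (ux * vx + uy * vy)) by ring.
    rewrite UV, U2, V2.
    transitivity ((a + b) * (a + b) * (a + c) * (a + c) * (1 - co * co)); [ring|].
    rewrite <- H1; ring. }
assert (X : (a + b) * vx = (a + c) * (ux * co - uy * si)).
{ apply Rmult_eq_reg_l with (a + b); [|lra].
  transitivity ((ux * ux + uy * uy) * vx); [rewrite U2; ring|].
  transitivity (ux * (ux * vx + uy * vy) - uy * (ux * vy - uy * vx)); [ring|].
  rewrite UV, UxV; ring. }
assert (Y : (a + b) * vy = (a + c) * (ux * si + uy * co)).
{ apply Rmult_eq_reg_l with (a + b); [|lra].
  transitivity ((ux * ux + uy * uy) * vy); [rewrite U2; ring|].
  transitivity (uy * (ux * vx + uy * vy) + ux * (ux * vy - uy * vx)); [ring|].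
  rewrite UV, UxV; ring. }
replace ux with ((a + b) * (fst e * cos phi - snd e * sin phi)) in *
  by (unfold ux; lra).
replace uy with ((a + b) * (fst e * sin phi + snd e * cos phi)) in *
  by (unfold uy; lra).
split; apply Rmult_eq_reg_l with (a + b); try lra.
- replace (fst z2) with (fst z0 + vx) by (unfold vx; ring).
  rewrite Rmult_plus_distr_l, X; ring.
- replace (snd z2) with (snd z0 + vy) by (unfold vy; ring).
  rewrite Rmult_plus_distr_l, Y; ring.
Qed.

End Corner.

(** * The six triangles around a vertex turn exactly once *)

Section Flower.

Variables (z0 : C) (z : nat -> C) (a : R) (rad : nat -> R).
Hypothesis a_pos : 0 < a.
Hypothesis rad_pos : forall k, 0 < rad k.
Hypothesis tangent_center :
  forall k, (k <= 6)%nat -> Cmod (Cminus z0 (z k)) = a + rad k.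
Hypothesis tangent_next :
  forall k, (k < 6)%nat -> Cmod (Cminus (z k) (z (S k))) = rad k + rad (S k).
Hypothesis oriented :
  forall k, (k < 6)%nat -> counterclockwise z0 (z k) (z (S k)).
Hypothesis closed : z 6%nat = z 0%nat.

Let angle k := 2 * half_angle a (rad k) (rad (S k)).

(** Accumulated in the reals, since the number of full turns is what has to be found. *)
Fixpoint direction (k : nat) : R :=
  match k with
  | O => 0
  | S j => direction j + angle j
  end.

Lemma angle_bound k : 0 < angle k < PI.
Proof.
assert (H := half_angle_bound a (rad k) (rad (S k)) a_pos
  (rad_pos _) (rad_pos _)); unfold angle; lra.
Qed.

Let e : C :=
  ((fst (z 0%nat) - fst z0) / (a + rad 0%nat),
   (snd (z 0%nat) - snd z0) / (a + rad 0%nat)).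

Lemma petal_polar k : (k <= 6)%nat ->
  fst (z k) = fst z0 + (a + rad k) *
    (fst e * cos (direction k) - snd e * sin (direction k)) /\
  snd (z k) = snd z0 + (a + rad k) *
    (fst e * sin (direction k) + snd e * cos (direction k)).
Proof.
induction k as [|k IH]; intro Hk.
- cbn; rewrite cos_0, sin_0; assert (H := rad_pos 0); split; field; lra.
- destruct (IH ltac:(lia)) as [Hx Hy].
  apply (corner_rotation z0 (z k) (z (S k)) e a (rad k) (rad (S k)));
    auto with arith.
  rewrite (Rplus_comm (rad (S k))), <- (tangent_center (S k)) by easy.
  rewrite <- Cmod_opp; f_equal; ring.
Qed.

(** The last petal is the first one again, so rotation by the total angle fixes the unit vector
    [e]. *)
Lemma cos_direction_6 : cos (direction 6) = 1.
Proof.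
assert (Ra := rad_pos 0); assert (Ra6 := rad_pos 6).
destruct (petal_polar 6 (le_n _)) as [Hx Hy].
assert (T6 := tangent_center 6 (le_n _)).
(* The equality of [rad 6] and [rad 0] is deduced from equal distances to [z0]. *)
rewrite closed, (tangent_center 0) in T6 by lia.
rewrite closed in Hx, Hy.
replace (rad 6%nat) with (rad 0%nat) in Hx, Hy by lra.
assert (N := Cmod_sqr (Cminus z0 (z 0%nat))).
rewrite tangent_center in N by lia.
unfold Cminus, Cplus, Copp in N; simpl in N.
set (co := cos (direction 6)) in *; set (si := sin (direction 6)) in *.
set (p := a + rad 0%nat) in *.
assert (Hp : 0 < p) by (unfold p; lra).
assert (Ex : fst (z 0%nat) = fst z0 + p * fst e) by (simpl; field; lra).
assert (Ey : snd (z 0%nat) = snd z0 + p * snd e) by (simpl; field; lra).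
rewrite Ex in Hx, N; rewrite Ey in Hy, N.
apply Rplus_eq_reg_l, Rmult_eq_reg_l in Hx; [|lra].
apply Rplus_eq_reg_l, Rmult_eq_reg_l in Hy; [|lra].
assert (N1 : fst e * fst e + snd e * snd e = 1).
{ apply Rmult_eq_reg_l with (p * p); [|nra].
  rewrite Rmult_1_r; rewrite N at 2; ring. }
set (x := fst e) in *; set (y := snd e) in *.
transitivity ((x * x + y * y) * co); [rewrite N1; ring|].
transitivity (x * (x * co - y * si) + y * (x * si + y * co)); [ring|].
rewrite <- Hx, <- Hy; exact N1.
Qed.

Hypothesis univalent : forall i j, (i < 6)%nat -> (j < 6)%nat -> i <> j ->
  disjoint (Cinterior (Defs.triangle z0 (z i) (z (S i))))
           (Cinterior (Defs.triangle z0 (z j) (z (S j)))).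

(* A direction just after the first petal, after one full turn, would lie in
   another sector as well. *)
Lemma direction_no_second_turn k : (1 <= k < 6)%nat ->
  direction k <= 2 * PI < direction (S k) -> False.
Proof.
intros Hk [H1 H2].
pose (psi := Rmin (direction 1) (direction (S k) - 2 * PI) / 2).
assert (B0 := angle_bound 0); assert (Bk := angle_bound k).
assert (D1 : direction 1 = angle 0) by (cbn; ring).
assert (Dk : direction (S k) = direction k + angle k) by easy.
assert (Hpsi : 0 < psi < direction 1 /\ psi + 2 * PI < direction (S k)).
{ unfold psi, Rmin; destruct Rle_dec; lra. }
destruct (petal_polar 0 ltac:(lia)) as [X0 Y0].
destruct (petal_polar 1 ltac:(lia)) as [X1 Y1].
destruct (petal_polar k ltac:(lia)) as [Xk Yk].
destruct (petal_polar (S k) ltac:(lia)) as [Xk' Yk'].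
assert (Rp : forall i, 0 < a + rad i) by (intro i; assert (H := rad_pos i); lra).
destruct (sector_interior z0 (z 0%nat) (z 1%nat) e _ _ (direction 0)
  (direction 1) psi (oriented 0 ltac:(lia)) (Rp _) (Rp _)
  ltac:(change (direction 0) with 0; lra) ltac:(change (direction 0) with 0; lra)
  X0 Y0 X1 Y1)
  as (d & Hd & I1).
destruct (sector_interior z0 (z k) (z (S k)) e _ _ (direction k)
  (direction (S k)) (psi + 2 * PI) (oriented k ltac:(lia)) (Rp _) (Rp _)
  ltac:(lra) ltac:(lra) Xk Yk Xk' Yk')
  as (d' & Hd' & I2).
pose (s := Rmin d d' / 2).
assert (Hs : 0 < s < d /\ s < d').
{ unfold s, Rmin; destruct Rle_dec; lra. }
specialize (I1 s ltac:(lra)); specialize (I2 s ltac:(lra)).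
rewrite cos_plus, sin_plus, cos_2PI, sin_2PI in I2.
rewrite !Rmult_0_r, !Rmult_1_r, Rminus_0_r, Rplus_0_r in I2.
apply (univalent 0 k ltac:(lia) ltac:(lia) ltac:(lia) _ (conj I1 I2)).
Qed.

Lemma direction_6 : direction 6 = 2 * PI.
Proof.
assert (B0 := angle_bound 0); assert (B1 := angle_bound 1).
assert (B2 := angle_bound 2); assert (B3 := angle_bound 3).
assert (B4 := angle_bound 4); assert (B5 := angle_bound 5).
assert (D : direction 6 = 2 * (direction 6 / 2)) by field.
assert (E := cos_direction_6); rewrite D, cos_2a_sin in E.
assert (S0 : sin (direction 6 / 2) = 0).
{ apply Rsqr_0_uniq; unfold Rsqr; lra. }
destruct (sin_eq_0_0 _ S0) as [k Hk].
assert (Bd : 0 < direction 6 / 2 < 3 * PI) by (cbn; lra).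
rewrite Hk in Bd; assert (HPI := PI_RGT_0).
assert (K : (0 < k < 3)%Z).
{ split; apply lt_IZR; apply Rmult_lt_reg_r with PI; lra. }
(* [k] counts full turns, and six angles below [PI] leave one or two. With two, some step after the
   first crosses [2 * PI], and the possible steps are excluded in order. *)
assert (K' : k = 1%Z \/ k = 2%Z) by lia; destruct K' as [->| ->]; [lra|exfalso].
assert (Hk1 : forall k, direction (S k) = direction k + angle k) by easy.
assert (direction 1 = angle 0) by (cbn; ring).
destruct (Rlt_le_dec (2 * PI) (direction 2)) as [L2|L2].
{ apply (direction_no_second_turn 1 ltac:(lia)); lra. }
destruct (Rlt_le_dec (2 * PI) (direction 3)) as [L3|L3].
{ now apply (direction_no_second_turn 2 ltac:(lia)). }
destruct (Rlt_le_dec (2 * PI) (direction 4)) as [L4|L4].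
{ now apply (direction_no_second_turn 3 ltac:(lia)). }
destruct (Rlt_le_dec (2 * PI) (direction 5)) as [L5|L5].
{ now apply (direction_no_second_turn 4 ltac:(lia)). }
apply (direction_no_second_turn 5 ltac:(lia)); lra.
Qed.

End Flower.

(** * From packings to the angle equation *)

(* Counterclockwise; [neighbor m n 6] is [neighbor m n 0] again. *)
Definition neighbor (m n : Z) (k : nat) : vertex :=
  match k with
  | 1 => (m, n + 1)%Z
  | 2 => (m - 1, n + 1)%Z
  | 3 => (m - 1, n)%Z
  | 4 => (m, n - 1)%Z
  | 5 => (m + 1, n - 1)%Z
  | _ => (m + 1, n)%Z
  end%nat.

(** The quadratic form is the squared modulus of [x + y * exp (i * PI / 3)]. *)
Lemma adjacentP v w :
  let x := (fst v - fst w)%Z in let y := (snd v - snd w)%Z in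
  (x * x + x * y + y * y = 1)%Z -> adjacent v w.
Proof.
destruct v as [m n], w as [m' n']; simpl; intro H.
unfold adjacent, vertex_pos, Cmod, Cminus, Cplus, Copp, Cmult, RtoC; simpl.
rewrite cos_PI3, sin_PI3.
transitivity (sqrt 1); [f_equal|apply sqrt_1].
apply (f_equal IZR) in H; rewrite !plus_IZR, !mult_IZR, !minus_IZR in H.
assert (S3 : sqrt 3 * sqrt 3 = 3) by (apply sqrt_sqrt; lra).
set (x := IZR m - IZR m') in H; set (y := IZR n - IZR n') in H.
transitivity ((x + y / 2) * (x + y / 2) + y * y / 4 * (sqrt 3 * sqrt 3)).
- unfold x, y; field.
- rewrite S3; lra.
Qed.

Lemma positive_face_neighbor m n k : (k < 6)%nat ->
  positive_face (m, n) (neighbor m n k) (neighbor m n (S k)).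
Proof.
intro Hk; split.
- do 6 (destruct k as [|k]; [repeat split; apply adjacentP; simpl; ring|]); lia.
- rewrite counterclockwiseE.
  assert (S3 : 0 < sqrt 3) by (apply sqrt_lt_R0; lra).
  do 6 (destruct k as [|k]; [
    unfold vertex_pos, Cplus, Cmult, RtoC; simpl;
    rewrite ?plus_IZR, ?minus_IZR, cos_PI3, sin_PI3;
    ring_simplify; lra|]); lia.
Qed.

Lemma neighbor_inj m n i j : (i < 6)%nat -> (j < 6)%nat ->
  neighbor m n i = neighbor m n j -> i = j.
Proof.
intros Hi Hj.
do 6 (destruct i as [|i]; [do 6 (destruct j as [|j];
  [easy || (intro H; exfalso; injection H; lia)|]); lia|]); lia.
Qed.

Lemma packing_flower (P : vertex -> circle) :
  circle_packing P -> locally_univalent P ->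
  forall m n, flower (fun m n => radius (P (m, n))) m n = PI.
Proof.
intros [Htan Hor] Huniv m n.
pose (v := neighbor m n).
assert (Hf : forall k, (k < 6)%nat -> positive_face (m, n) (v k) (v (S k))).
{ intros k Hk; now apply positive_face_neighbor. }
assert (H := direction_6 (center (P (m, n))) (fun k => center (P (v k)))
  (radius (P (m, n))) (fun k => radius (P (v k)))).
enough (E : direction (radius (P (m, n))) (fun k => radius (P (v k))) 6 = 2 * PI).
{ unfold flower; cbn in E; lra. }
apply H; clear H.
- apply radius_pos.
- intro k; apply radius_pos.
- intros k Hk; apply Htan; destruct (Nat.eq_dec k 6) as [->|N].
  + apply (Hf 0%nat); lia.
  + apply (Hf k); lia.
- intros k Hk; apply Htan, (Hf k Hk).
- intros k Hk; apply Hor, (Hf k Hk).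
- easy.
- intros i j Hi Hj Hij; apply (Huniv (m, n)); auto.
  intro E; injection E; intros _ E1.
  now apply Hij, (neighbor_inj m n).
Qed.

(** * Flowers with geometric rows *)

(* Radii 1 at the center and [x], [y], [y / x], [/ x] around it. *)
Definition half_flower (x y : R) : R :=
  half_angle 1 x y + half_angle 1 y (y / x) + half_angle 1 (y / x) (/ x).

(** Each angle grows with either neighboring radius. In the middle angle both radii depend on [y],
    so they are raised one after the other. *)
Lemma half_flower_lt x y y' : 0 < x -> 0 < y -> y < y' ->
  half_flower x y < half_flower x y'.
Proof.
intros Hx Hy Hyy; unfold half_flower.
assert (Hi := Rinv_0_lt_compat x Hx).
assert (Hq : 0 < y / x) by now apply Rdiv_lt_0_compat.
assert (Hqq : y / x < y' / x) by now apply Rmult_lt_compat_r.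
assert (H1 := half_angle_lt 1 x y y' Rlt_0_1 Hx Hy Hyy).
assert (H2 := half_angle_lt 1 y (y / x) (y' / x) Rlt_0_1 Hy Hq Hqq).
assert (H3 := half_angle_lt 1 (y' / x) y y' Rlt_0_1 ltac:(lra) Hy Hyy).
assert (H4 := half_angle_lt 1 (/ x) (y / x) (y' / x) Rlt_0_1 Hi Hq Hqq).
rewrite (half_angle_sym 1 (y' / x) y) in H2.
rewrite (half_angle_sym 1 (y' / x) y'), !(half_angle_sym 1 (/ x) (_ / x)).
lra.
Qed.

(* The six triangles of a Doyle spiral flower fall into two similarity classes,
   and each class contributes its three angles. *)
Lemma half_flower_opp x y : 0 < x -> 0 < y ->
  half_flower x y + half_flower (/ x) (/ y) = PI.
Proof.
intros Hx Hy; unfold half_flower.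
assert (Hi := Rinv_0_lt_compat x Hx); assert (Hj := Rinv_0_lt_compat y Hy).
assert (Hq : 0 < y / x) by now apply Rdiv_lt_0_compat.
assert (S1 := half_angle_sum 1 x y Rlt_0_1 Hx Hy).
assert (S2 := half_angle_sum 1 y (y / x) Rlt_0_1 Hy Hq).
(* The angles of the triangles [(1, x, y)] and [(1, y, y / x)] are rescaled to have the radius at
   their vertex equal to 1, which matches the six terms of the goal. *)
rewrite <- (half_angle_scale (/ x) x y 1) in S1 by lra.
rewrite <- (half_angle_scale (/ y) y 1 x) in S1 by lra.
rewrite <- (half_angle_scale (/ y) y (y / x) 1) in S2 by lra.
rewrite <- (half_angle_scale (/ (y / x)) (y / x) 1 y) in S2
  by (try apply Rinv_0_lt_compat; lra).
replace (/ x * x) with 1 in S1 by (field; lra).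
replace (/ y * y) with 1 in S1, S2 by (field; lra).
replace (/ (y / x) * (y / x)) with 1 in S2 by (field; lra).
replace (/ x * y) with (y / x) in S1 by (field; lra).
replace (/ y * x) with (/ y / / x) in S1 by (field; lra).
replace (/ y * (y / x)) with (/ x) in S2 by (field; lra).
replace (/ (y / x) * 1) with (/ y / / x) in S2 by (field; lra).
replace (/ (y / x) * y) with (/ / x) in S2 by (field; lra).
rewrite !Rmult_1_r in *; lra.
Qed.

(** Scaling makes the central radius 1. The lower half is the upper one turned by [PI], which
    replaces [x] by [/ x]. *)
Lemma flower_geometric (r : Z -> Z -> R) (x : R) (m n : Z) :
  (forall m n, 0 < r m n) -> 0 < x ->
  (forall m n, r (m + 1)%Z n = x * r m n) ->
  flower r m n = half_flower x (r m (n + 1)%Z / r m n) +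
                 half_flower (/ x) (r m (n - 1)%Z / r m n).
Proof.
intros r_pos Hx Hr.
assert (Hl : forall m n, r (m - 1)%Z n = r m n / x).
{ intros i j; rewrite <- (Z.sub_simpl_r i 1) at 2; rewrite Hr; field; lra. }
assert (H0 := r_pos m n); assert (H1 := r_pos m (n + 1)%Z).
assert (H2 := r_pos m (n - 1)%Z).
unfold flower, half_flower; rewrite !Hr, !Hl.
assert (Sc : forall b c b' c', 0 < b -> 0 < c -> b' = b / r m n ->
  c' = c / r m n -> half_angle (r m n) b c = half_angle 1 b' c').
{ intros b c b' c' Hb Hc -> ->.
  rewrite <- (half_angle_scale (/ r m n) (r m n) b c)
    by (try apply Rinv_0_lt_compat; easy).
  f_equal; field; lra. }
rewrite <- !Rplus_assoc; repeat apply (f_equal2 Rplus); apply Sc;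
  first [easy | now apply Rmult_lt_0_compat | now apply Rdiv_lt_0_compat |
    field; lra].
Qed.

(** * Geometric sequences and the classification *)

Lemma Z_constant (A : Type) (f : Z -> A) :
  (forall k, f k = f (k + 1)%Z) -> forall k, f k = f 0%Z.
Proof.
intro H; apply Z.peano_ind; [easy| |].
- intros k <-; symmetry; apply H.
- intros k <-; rewrite (H (Z.pred k)); f_equal; lia.
Qed.

Lemma geometric_powerRZ (f : Z -> R) (q : R) : 0 < q ->
  (forall k, f (k + 1)%Z = q * f k) -> forall k, f k = f 0%Z * powerRZ q k.
Proof.
intros Hq H k.
assert (P : forall k, 0 < powerRZ q k) by (intro; now apply powerRZ_lt).
assert (C := Z_constant _ (fun k => f k / powerRZ q k)); cbv beta in C.
assert (E : f k / powerRZ q k = f 0%Z / powerRZ q 0).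
{ apply C; clear k; intro k; rewrite H, powerRZ_add, powerRZ_1 by lra.
  assert (Pk := P k); field; lra. }
assert (Pk := P k); simpl in E.
replace (f 0%Z) with (f 0%Z / 1) by field; rewrite <- E; field; lra.
Qed.

Theorem theorem1p6 (P : vertex -> circle)
    (hpack : circle_packing P)
    (huniv : locally_univalent P)
    (hratio : exists c : R, (0 < c)%R /\
       forall m n : Z,
         (radius (P ((m + 1)%Z, n)) / radius (P (m, n)) >= c)%R) :
  regular_hexagonal_packing P \/ doyle_spiral P.
Proof.
(* Regular packings are the Doyle spirals with [x = y = 1], so the second alternative is established
   in all cases. *)
right; split; [easy|].
pose (r := fun m n => radius (P (m, n))).
assert (r_pos : forall m n, 0 < r m n) by (intros; apply radius_pos).
assert (Hfl : forall m n, flower r m n = PI) by now apply packing_flower.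
destruct hratio as (c & Hc & Hratio).
(* The ratio bound gives [W >= 1] for this choice. *)
pose (s := ln c - 1).
pose (W := fun m n => ln (r (m + 1)%Z n / r m n) - s).
assert (q_pos : forall m n, 0 < r (m + 1)%Z n / r m n).
{ intros; now apply Rdiv_lt_0_compat. }
assert (W_pos : forall m n, 0 < W m n).
{ intros m n; assert (H := ln_le _ _ Hc (Rge_le _ _ (Hratio m n))).
  unfold W, s, r; lra. }
assert (Hexp : forall m n, r m n * exp (W m n + s) = r (m + 1)%Z n).
{ intros m n; unfold W; rewrite Rplus_comm, Rplus_minus, exp_ln by easy.
  field; apply Rgt_not_eq, r_pos. }
assert (HW : forall m n, W m n = W (m + 1)%Z n /\ W m n = W m (n + 1)%Z).
(* The second family of radii is the packing translated by one step in [m], whose flowers also total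
   [PI]. *)
{ apply (liouville r W s r_pos W_pos); intros m n.
  rewrite Hfl, <- (Hfl (m + 1)%Z n); unfold flower; rewrite !Hexp.
  now replace (m - 1 + 1)%Z with (m + 1 - 1)%Z by ring. }
assert (WC : forall m n, W m n = W 0%Z 0%Z).
{ intros m n; rewrite (Z_constant _ (fun m => W m n)) by (intro; apply HW).
  apply (Z_constant _ (W 0%Z)); intro; apply HW. }
pose (x := exp (W 0%Z 0%Z + s)); assert (Hx : 0 < x) by apply exp_pos.
assert (Hr : forall m n, r (m + 1)%Z n = x * r m n).
{ intros m n; rewrite <- Hexp, WC; apply Rmult_comm. }
pose (y := fun n => r 0%Z (n + 1)%Z / r 0%Z n).
assert (y_pos : forall n, 0 < y n) by (intro; now apply Rdiv_lt_0_compat).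
assert (Hy : forall n, y n = y (n + 1)%Z).
{ intro n.
  (* The equation at [(0, n + 1)] has upper ratio [y (n + 1)] and lower ratio [/ y n]. By
     [half_flower_opp] the upper ratio [y n] solves it too, and strict monotonicity identifies the
     two. *)
  assert (F := flower_geometric r x 0 (n + 1) r_pos Hx Hr); rewrite Hfl in F.
  rewrite Z.add_simpl_r in F; fold (y (n + 1)%Z) in F.
  replace (r 0%Z n / r 0%Z (n + 1)%Z) with (/ y n) in F.
  2: { unfold y; field; split; apply Rgt_not_eq, r_pos. }
  assert (G := half_flower_opp x (y n) Hx (y_pos n)).
  destruct (Rtotal_order (y n) (y (n + 1)%Z)) as [H|[H|H]]; [|easy|];
    apply (half_flower_lt x) in H; auto; lra. }
exists (r 0%Z 0%Z), x, (y 0%Z); repeat split; auto.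
intros m n; change (radius (P (m, n))) with (r m n).
rewrite (geometric_powerRZ (fun m => r m n) x Hx) by (intro; apply Hr).
rewrite (geometric_powerRZ (r 0%Z) (y 0%Z) (y_pos 0%Z)); [ring|].
intro k; rewrite <- (Z_constant _ y Hy k); unfold y; field.
apply Rgt_not_eq, r_pos.
Qed.
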